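(* Let $X$ be a smooth Banach space over $\mathbb{C}$ and let $T\in B(X)$ be a self-adjoint operator such that $T^2-\mu(T)^2 I$ is strongly normal. Then $T$ attains its minimum modulus if and only if $\mu(T)$ or $-\mu(T)$ is an eigenvalue of $T$.
   Context: $B(X)$ is the space of bounded linear operators on $X$, $S_X=\{x\in X:\|x\|=1\}$, $X^*$ is the space of bounded linear functionals on $X$. $X$ is smooth if every $x\in S_X$ admits a unique $x^*\in S_{X^*}$ with $x^*(x)=1$. The duality mapping $J:X\to X^*$ of a smooth Banach space assigns to each $x$ the unique functional $J(x)$ with $\|J(x)\|=\|x\|$ and $J(x)(x)=\|x\|^2$. For $T\in B(X)$ the transpose $T':X^*\to X^*$ is $(T'f)(x)=f(Tx)$. $T\in B(X)$ is self-adjoint if $T'\circ J=J\circ T$; $T$ is strongly normal if $T=S^2$ for some self-adjoint $S\in B(X)$. The minimum modulus is $\mu(T)=\inf\{\|Tx\|:x\in S_X\}$; $T$ attains its minimum modulus if there is $x_0\in S_X$ with $\|Tx_0\|=\mu(T)$. *)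

(* Defs.v *)
(* Norms of normed spaces over R[i] take values in R[i]
   (they are real, nonnegative elements); rnorm reads them in R. *)
From mathcomp Require Import all_boot all_order all_algebra.
From mathcomp Require Import all_classical all_reals all_analysis.
From mathcomp Require Import complex.

Set Implicit Arguments.
Unset Strict Implicit.
Unset Printing Implicit Defensive.

Import Order.TTheory GRing.Theory Num.Theory.
Import numFieldNormedType.Exports.

Local Open Scope classical_set_scope.
Local Open Scope ring_scope.
Local Open Scope complex_scope.

Section Operators.
Variable R : realType.
Implicit Types V W X : normedModType R[i].

Definition rnorm V (x : V) : R := complex.Re `|x|.

Definition unit_sphere V : set V := [set x | rnorm x = 1].

Definition bounded_linear V W : set (V -> W) :=
  [set f | linear f /\ exists M : R, forall x, rnorm (f x) <= M * rnorm x].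

(* The supremum is over the closed unit ball, so that it is taken over a
   nonempty set also for V = {0}; it is the operator norm when f is bounded. *)
Definition opnorm V W (f : V -> W) : R :=
  sup [set rnorm (f x) | x in [set x | rnorm x <= 1]].

Definition dual X : set (X -> R[i]^o) := @bounded_linear X R[i]^o.

Definition smooth X : Prop :=
  forall x : X, unit_sphere x ->
    exists! f : X -> R[i]^o, [/\ dual f, opnorm f = 1 & f x = 1].

(* The default value 0 is irrelevant when X is smooth: there is then exactly
   one functional with the required properties. *)
Definition duality_map X (x : X) : X -> R[i]^o :=
  xget (fun=> 0)
    [set f | [/\ dual f, opnorm f = rnorm x & f x = (rnorm x ^+ 2)%:C]].

Definition transpose X (T : X -> X) (f : X -> R[i]^o) : X -> R[i]^o := f \o T.

Definition self_adjoint X (T : X -> X) : Prop :=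
  transpose T \o @duality_map X = @duality_map X \o T.

Definition strongly_normal X (T : X -> X) : Prop :=
  exists S : X -> X, [/\ bounded_linear S, self_adjoint S & T = S \o S].

Definition min_modulus X (T : X -> X) : R :=
  inf [set rnorm (T x) | x in @unit_sphere X].

Definition attains_min_modulus X (T : X -> X) : Prop :=
  exists2 x0 : X, unit_sphere x0 & rnorm (T x0) = min_modulus T.

Definition eigenvalue_of X (T : X -> X) (a : R[i]) : Prop :=
  exists2 x, x != 0 & T x = a *: x.

End Operators.

(* Main.v *)
Require Import Defs.
From mathcomp Require Import all_boot all_order all_algebra.
From mathcomp Require Import all_classical all_reals all_analysis.
From mathcomp Require Import complex.

Set Implicit Arguments.
Unset Strict Implicit.
Unset Printing Implicit Defensive.

Import GRing.Theory numFieldNormedType.Exports.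
Import Order.TTheory Num.Theory.

(** The duality map [J] plays the part of an inner product: for a self-adjoint
    operator [T], [J x (T (T x)) = J (T x) (T x) = ||T x||^2]
    ([duality_map_self_adjoint]).

    Write [m] for the minimum modulus, and [T^2 - m^2 = S^2] with [S]
    self-adjoint.  If a unit vector [x0] satisfies [||T x0|| = m], applying
    [J x0] to [S (S x0) = T (T x0) - m^2 x0] gives
    [||S x0||^2 = ||T x0||^2 - m^2 = 0], by the above identity for [S] and for
    [T].  So [S x0 = 0] and [(T - m) (T + m) x0 = 0]: either [x0] is an
    eigenvector for [- m], or [(T + m) x0] is one for [m]
    ([eigenvalue_square]).  Conversely, a normalized
    eigenvector for [m] or [- m] realizes the infimum ([eigenvalue_attains]).

    The remaining work is to show that [J x] exists for every [x], since
    smoothness provides a norming functional at unit vectors only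
    ([duality_mapP]). *)

Local Open Scope classical_set_scope.
Local Open Scope ring_scope.
Local Open Scope complex_scope.

Section RealNorm.
Variables (R : realType) (V : normedModType R[i]).

Lemma normE (x : V) : `|x| = (rnorm x)%:C.
Proof. by rewrite /rnorm RRe_real ?normr_real. Qed.

Lemma rnorm_ge0 (x : V) : 0 <= rnorm x.
Proof. by rewrite -ler0c -normE. Qed.

Lemma rnorm0 : rnorm (0 : V) = 0.
Proof. by rewrite /rnorm normr0. Qed.

Lemma rnorm_eq0 (x : V) : rnorm x = 0 -> x = 0.
Proof. by move=> x0; apply/eqP; rewrite -normr_eq0 normE x0. Qed.

Lemma norm_real (t : R) : `|t%:C| = `|t|%:C.
Proof. by rewrite normc_def /= expr0n addr0 sqrtr_sqr. Qed.

Lemma rnormZ (t : R) (x : V) : rnorm (t%:C *: x) = `|t| * rnorm x.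
Proof. by apply: complexI; rewrite -normE normrZ norm_real normE rmorphM. Qed.

Lemma rnorm_normalize (x : V) : x != 0 -> rnorm ((rnorm x)^-1%:C *: x) = 1.
Proof.
move=> x0; rewrite rnormZ normfV ger0_norm ?rnorm_ge0// mulVf//.
by apply: contra_neq x0; exact: rnorm_eq0.
Qed.

End RealNorm.

Section Duality.
Variables (R : realType) (X : normedModType R[i]).
Implicit Types (x y : X) (f : X -> R[i]^o).

Lemma rnorm_le_opnorm f x : dual f -> rnorm x <= 1 -> rnorm (f x) <= opnorm f.
Proof.
move=> [_ [M fM]] x1; apply: ub_le_sup; last by exists x.
exists `|M| => _ [y y1 <-]; apply: (le_trans (fM y)).
apply: (@le_trans _ _ (`|M| * rnorm y)).
  by rewrite ler_wpM2r ?rnorm_ge0// ler_norm.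
by rewrite ler_piMr.
Qed.

Lemma opnorm_le f (c : R) :
  (forall x, rnorm x <= 1 -> rnorm (f x) <= c) -> opnorm f <= c.
Proof.
move=> fc; apply: ge_sup; last by move=> _ [x x1 <-]; exact: fc.
by exists (rnorm (f 0)), 0 => //=; rewrite rnorm0.
Qed.

(** A norming functional [f] at the unit vector [x / ||x||] yields the
    functional [||x|| f] at [x]; its operator norm is bounded below by
    evaluating it at [x / ||x||]. *)
Lemma duality_mapP : smooth X -> forall x,
  [/\ dual (duality_map x), opnorm (duality_map x) = rnorm x
    & duality_map x x = (rnorm x ^+ 2)%:C].
Proof.
move=> smoothX x; rewrite /duality_map.
set P := [set f | _]; apply: (@xgetPex _ _ P); rewrite /P /=.
have [->|x0] := eqVneq x 0.
  have d0 : dual (fun _ : X => 0 : R[i]^o).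
    split; first by move=> a u v /=; rewrite scaler0 addr0.
    by exists 0 => y; rewrite rnorm0 mul0r.
  exists (fun=> 0); rewrite rnorm0 expr0n; split=> //.
  apply/eqP; rewrite eq_le; apply/andP; split.
    by apply: opnorm_le => y _; rewrite rnorm0.
  rewrite -[X in X <= _](@rnorm0 _ R[i]^o).
  by apply: (@rnorm_le_opnorm (fun=> 0) 0 d0); rewrite rnorm0.
have r0 : rnorm x != 0 by apply: contra_neq x0; exact: rnorm_eq0.
set u := (rnorm x)^-1%:C *: x.
have u1 : rnorm u = 1 by exact: rnorm_normalize.
have xE : x = (rnorm x)%:C *: u.
  by rewrite /u scalerA -rmorphM/= divff// scale1r.
have [f [[df f1 fu] _]] := smoothX u u1.
pose g : X -> R[i]^o := fun y => (rnorm x)%:C *: f y.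
have g_le y : rnorm (g y) = rnorm x * rnorm (f y).
  by rewrite /g rnormZ ger0_norm ?rnorm_ge0.
have dg : dual g.
  have [lf [M fM]] := df; split.
    move=> a y z; rewrite /g lf scalerDr; congr (_ + _).
    by rewrite !scalerA mulrC.
  exists (rnorm x * M) => y.
  by rewrite g_le -mulrA ler_wpM2l ?rnorm_ge0.
have gu : g u = (rnorm x)%:C by rewrite /g fu; exact: mulr1.
exists g; split=> //.
  apply/eqP; rewrite eq_le; apply/andP; split.
    apply: opnorm_le => y y1; rewrite g_le -[leRHS]mulr1.
    by rewrite ler_wpM2l ?rnorm_ge0// -f1 rnorm_le_opnorm.
  have <- : rnorm (g u) = rnorm x by rewrite g_le fu /rnorm normr1 mulr1.
  by rewrite rnorm_le_opnorm// u1.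
have /scalable_linear lg := dg.1.
by rewrite [X in g X]xE lg gu expr2 rmorphM.
Qed.

(** Self-adjointness trades one factor [T] in the argument for a [T] inside the
    duality map. *)
Lemma duality_map_self_adjoint (T : X -> X) x :
  smooth X -> self_adjoint T ->
  duality_map x (T (T x)) = (rnorm (T x) ^+ 2)%:C.
Proof.
move=> smoothX saT; have [_ _ <-] := duality_mapP smoothX (T x).
by have /(congr1 (fun F => F x (T x))) := saT.
Qed.

Lemma min_modulus_ge0 (T : X -> X) : 0 <= min_modulus T.
Proof.
rewrite /min_modulus; set A := [set rnorm _ | _ in _].
(* the unit sphere of the zero space is empty, and [inf set0 = 0] *)
have [->|/set0P A0] := eqVneq A set0; first by rewrite inf0.
by apply: lb_le_inf => // _ [y _ <-]; exact: rnorm_ge0.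
Qed.

Lemma eigenvalue_attains (T : X -> X) (t : R) : bounded_linear T ->
  `|t| = min_modulus T -> eigenvalue_of T t%:C -> attains_min_modulus T.
Proof.
move=> [lT _] tE [x x0 Tx]; exists ((rnorm x)^-1%:C *: x).
  exact: rnorm_normalize.
rewrite (scalable_linear lT) /= Tx.
by rewrite scalerA mulrC -scalerA rnormZ rnorm_normalize// mulr1.
Qed.

(** Because [(T - t) (T + t) x = 0], the vector [(T + t) x] either vanishes or
    is an eigenvector for [t]. *)
Lemma eigenvalue_square (T : X -> X) (t : R[i]) x : linear T -> x != 0 ->
  T (T x) = t ^+ 2 *: x -> eigenvalue_of T t \/ eigenvalue_of T (- t).
Proof.
move=> lT x0 TTx.
have [yE|y0] := eqVneq (t *: x + T x) 0.
  right; exists x => //; rewrite scaleNr.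
  by apply/eqP; rewrite -addr_eq0 addrC yE.
left; exists (t *: x + T x) => //.
by rewrite lT TTx scalerDr scalerA -expr2 addrC.
Qed.

End Duality.

Theorem proposition2 (R : realType) (X : completeNormedModType R[i])
    (smoothX : smooth X) (T : X -> X) (T_BX : bounded_linear T)
    (T_sa : self_adjoint T)
    (T_sn : strongly_normal
      (fun x => T (T x) - (min_modulus T ^+ 2)%:C *: x)) :
  attains_min_modulus T <->
  (eigenvalue_of T (min_modulus T)%:C \/
   eigenvalue_of T (- min_modulus T)%:C).
Proof.
split; last first.
  have mE := ger0_norm (min_modulus_ge0 T).
  case; first exact: eigenvalue_attains.
  by apply: eigenvalue_attains => //; rewrite normrN.
move=> [x x1 Tx]; have [S [[lS _] S_sa SS]] := T_sn.
set m := min_modulus T in Tx SS *.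
have [[lJ _] _ Jx] := duality_mapP smoothX x.
have SSx : T (T x) = (m ^+ 2)%:C *: x + S (S x).
  have /= <- := congr1 (@^~ x) SS.
  by rewrite addrC subrK.
have Sx : S x = 0.
  apply: rnorm_eq0; apply/eqP; rewrite -sqrf_eq0 -(inj_eq (@complexI R)).
  rewrite -duality_map_self_adjoint//.
  have := duality_map_self_adjoint x smoothX T_sa.
  rewrite SSx lJ Jx Tx x1 expr1n => /eqP.
  by rewrite -subr_eq0 addrAC [_ *: _]mulr1 subrr add0r.
have S0 : S 0 = 0.
  by rewrite -(scale0r (0 : X)) (scalable_linear lS) /= !scale0r.
have -> : (- m)%:C = - m%:C by rewrite -rmorphN.
apply: (@eigenvalue_square _ _ _ _ x).
- by case: T_BX.
- apply/eqP => x0; move: x1; rewrite /unit_sphere /= x0 rnorm0 => /eqP.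
  by rewrite eq_sym oner_eq0.
- by rewrite SSx Sx S0 addr0 rmorphXn.
Qed.
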